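(* Let $n$ be a positive integer, let $\mathcal A$ be an abelian $n$-truncated DG-category, and let $f$ be a closed morphism of degree $0$ in $\mathcal A$. Then a $[1,n]$-factorization of $f$ (a factorization into a $1$-epimorphism followed by an $n$-monomorphism) exists and is unique up to homotopy equivalence of factorizations.
   Context: **DG-categories.** Let $k$ be a commutative ring. DG-categories are $k$-linear with cohomological grading (differential $d$ of degree $+1$). All DG-categories $\mathcal A$ are assumed non-positive: $\mathcal A(X,Y)^i=0$ for $i>0$. A morphism $f$ is closed if $d(f)=0$; a homotopy equivalence is a closed degree-$0$ morphism invertible in the homotopy category $H^0(\mathcal A)$. **Exactness.** For a chain map $\varphi:M\to N$ let $\mathrm{Fib}(\varphi)=\mathrm{Cone}(\varphi)[-1]$ be the complex $\mathrm{Fib}(\varphi)^i=M^i\oplus N^{i-1}$, $d(m,h)=(dm,-\varphi(m)-dh)$. A 3-term homotopy complex $(f,g,h)$ consists of closed degree-$0$ morphisms $f:X\to Y$, $g:Y\to Z$ and a degree $-1$ morphism $h:X\to Z$ with $d(h)=-g\circ f$. It is left exact (a homotopy kernel of $g$) if for every object $W$ and every $i\le 0$ the chain map $\mathcal A(W,X)\to \mathrm{Fib}(g\circ-:\mathcal A(W,Y)\to\mathcal A(W,Z))$, $u\mapsto (f\circ u,h\circ u)$, induces an isomorphism on $H^i$. It is right exact (a homotopy cokernel of $f$) if for every $W$ and $i\le0$ the chain map $\mathcal A(Z,W)\to\mathrm{Fib}(-\circ f:\mathcal A(Y,W)\to\mathcal A(X,W))$, $u\mapsto(u\circ g,(-1)^{|u|}u\circ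 h)$, induces an isomorphism on $H^i$. It is a homotopy short exact sequence if it is both. **Abelian $n$-truncated DG-categories.** For a positive integer $m$, a closed degree-$0$ morphism $f:X\to Y$ is an $m$-monomorphism if for every $W$ the map $H^i(f\circ-):H^i(\mathcal A(W,X))\to H^i(\mathcal A(W,Y))$ is injective for $i=-m+1$ and bijective for all $i\le -m$; it is an $m$-epimorphism if it is an $m$-monomorphism in $\mathcal A^{\mathrm{op}}$. $\mathcal A$ is $n$-truncated if $H^i(\mathcal A(X,Y))=0$ for all $X,Y$ and all $i\le -n$. $\mathcal A$ is abelian $n$-truncated if it is $n$-truncated and: (i) $H^0(\mathcal A)$ is additive and every closed degree-$0$ morphism has a homotopy kernel and a homotopy cokernel; (ii) every right exact $(f,g,h)$ with $f$ an $n$-monomorphism is a homotopy short exact sequence; (iii) every left exact $(f,g,h)$ with $g$ an $n$-epimorphism is a homotopy short exact sequence. **Factorizations.** A factorization of a closed degree-$0$ morphism $f:A\to A'$ is a triple $(e,m,\eta)$ with $e:A\to X$, $m:X\to A'$ closed of degree $0$ and $\eta:A\to A'$ of degree $-1$ with $d(\eta)=f-m\circ e$. It is a $[1,n]$-factorization if $e$ is a $1$-epimorphism and $m$ is an $n$-monomorphism. A morphism of factorizations of $f$ from $(e',m',\eta')$ (through $X_1$) to $(e,m,\eta)$ (through $X_0$) is $(t,h_e,h_m,\zeta)$ with $t:X_1\to X_0$ closed of degree $0$, $h_e:A\to X_0$ and $h_m:X_1\to A'$ of degree $-1$, $\zeta:A\to A'$ of degree $-2$, such that $d(h_e)=e-t\circ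 e'$, $d(h_m)=m'-m\circ t$, $d(\zeta)=-h_m\circ e'-\eta'+m\circ h_e+\eta$. Two factorizations are homotopy equivalent if there is a morphism of factorizations between them with $t$ a homotopy equivalence. *)

(* Defs.v *)
From HB Require Import structures.
From mathcomp Require Import all_boot all_order all_algebra.
Set Implicit Arguments.
Unset Strict Implicit.
Unset Printing Implicit Defensive.
Import Order.TTheory GRing.Theory Num.Theory.
Local Open Scope ring_scope.

(* Degrees are handled through explicit equations ([i + 1 = j], [i + j = l])
   rather than by fixing the index of a differential or of a composite, so
   that no transport along equalities of degrees appears in the axioms of a
   DG-category. *)

Definition sgn (k : comPzRingType) (i : int) : k := (-1) ^+ `|i|%N.
Arguments sgn {k} i.

Section Sign.
Variable k : comPzRingType.
Local Notation sgn := (@sgn k).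

Lemma sgn0 : sgn 0 = 1.
Proof. by rewrite /sgn absz0 expr0. Qed.

Lemma sgnS (i : int) : sgn (i + 1) = - sgn i.
Proof.
rewrite /sgn; case: i => n; first by rewrite -PoszD !absz_nat addn1 exprS mulN1r.
case: n => [|n]; first by rewrite /= expr0 expr1 opprK.
have -> : (Negz n.+1 + 1 : int) = Negz n.
  by rewrite !NegzE -[n.+2]addn1 PoszD opprD addrNK.
by rewrite !NegzE !abszN !absz_nat exprS mulN1r [in RHS]exprS mulN1r !opprK exprS mulN1r.
Qed.

Lemma sgnD (i j : int) : sgn (i + j) = sgn i * sgn j.
Proof.
elim: i => [|n IH|n IH]; first by rewrite add0r sgn0 mul1r.
  by rewrite -[n.+1]addn1 PoszD addrAC !sgnS IH mulNr.
apply: oppr_inj; rewrite -mulNr -!sgnS -[n.+1]addn1 PoszD opprD.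
by rewrite addrAC !addrNK.
Qed.

Lemma sgnN (i : int) : sgn (- i) = sgn i.
Proof. by rewrite /sgn abszN. Qed.

Lemma sgn_sqr (i : int) : sgn i * sgn i = 1.
Proof. by rewrite -{2}(sgnN i) -sgnD subrr sgn0. Qed.

End Sign.

Record cochain (k : comPzRingType) := Cochain {
  cobj :> int -> lmodType k;
  diff : forall i j : int, i + 1 = j -> cobj i -> cobj j;
  diff_lin : forall i j (e : i + 1 = j), linear (diff e);
  diffK : forall i j l (e : i + 1 = j) (e' : j + 1 = l) (x : cobj i),
    diff e' (diff e x) = 0
}.
Arguments diff {k c i j} e x.

HB.instance Definition _ k (C : cochain k) i j (e : i + 1 = j) :=
  GRing.isLinear.Build k (C i) (C j) _ (@diff k C i j e) (diff_lin e).

Section Cohomology.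
Variable k : comPzRingType.

Definition cocycle (C : cochain k) (i : int) (x : C i) : Prop :=
  diff (erefl (i + 1)) x = 0.

(* H^i(C) is the setoid of degree-i cocycles modulo this relation; injectivity,
   surjectivity and vanishing below are those of the induced maps and modules
   of classes. *)
Definition cohomologous (C : cochain k) (i : int) (x y : C i) : Prop :=
  exists z : C (i - 1), diff (subrK 1 i) z = x - y.

Record chain_map (C D : cochain k) := ChainMap {
  cm_fun :> forall i : int, C i -> D i;
  cm_lin : forall i, linear (@cm_fun i);
  cm_diff : forall i j (e : i + 1 = j) (x : C i),
    cm_fun (diff e x) = diff e (cm_fun x)
}.

Definition H_inj (C D : cochain k) (phi : chain_map C D) (i : int) : Prop :=
  forall x y : C i, cocycle x -> cocycle y ->
    cohomologous (phi i x) (phi i y) -> cohomologous x y.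

Definition H_surj (C D : cochain k) (phi : chain_map C D) (i : int) : Prop :=
  forall y : D i, cocycle y ->
    exists x : C i, cocycle x /\ cohomologous (phi i x) y.

Definition H_bij (C D : cochain k) (phi : chain_map C D) (i : int) : Prop :=
  H_inj phi i /\ H_surj phi i.

Definition H_zero (C : cochain k) (i : int) : Prop :=
  forall x : C i, cocycle x -> cohomologous x 0.

End Cohomology.

HB.instance Definition _ k (C D : cochain k) (phi : chain_map C D) i :=
  GRing.isLinear.Build k (C i) (D i) _ (@cm_fun k C D phi i) (cm_lin phi (i := i)).

(* Fib(phi) = Cone(phi)[-1]. *)
Section Fibre.
Variable k : comPzRingType.

Definition degcast (C : cochain k) (i j : int) (e : i = j) (x : C i) : C j :=
  ecast l (C l) e x.

Lemma degcast_lin (C : cochain k) i j (e : i = j) : linear (@degcast C i j e).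
Proof. by case: j / e. Qed.

HB.instance Definition _ (C : cochain k) i j (e : i = j) :=
  GRing.isLinear.Build k (C i) (C j) _ (@degcast C i j e) (degcast_lin e).

Lemma diff_degcast (C : cochain k) i i' j j' (e : i = i') (e' : j = j')
    (d : i + 1 = j) (d' : i' + 1 = j') (x : C i) :
  diff d' (degcast e x) = degcast e' (diff d x).
Proof.
case: i' / e d' => d'; case: j' / e' d' => d' /=.
by rewrite (eq_irrelevance d' d).
Qed.

Lemma degS_pred (i j : int) : i + 1 = j -> i = j - 1.
Proof. by move=> <-; rewrite addrK. Qed.

Lemma degS_shift (i j : int) : i + 1 = j -> i - 1 + 1 = j - 1.
Proof. by move=> <-; rewrite addrNK addrK. Qed.

Section Def.
Variables (M N : cochain k) (phi : chain_map M N).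

Definition fib_obj (i : int) : lmodType k := (M i * N (i - 1))%type.

Definition fib_diff (i j : int) (e : i + 1 = j) (p : fib_obj i) : fib_obj j :=
  (diff e p.1,
   - degcast (degS_pred e) (phi i p.1) - diff (degS_shift e) p.2).

Lemma fib_diff_lin i j (e : i + 1 = j) : linear (fib_diff e).
Proof.
move=> a [m h] [m' h']; rewrite /fib_diff /=; congr (_, _); first exact: linearP.
rewrite [phi i _]linearP [degcast _ _]linearP [diff _ (_ + _)]linearP.
by rewrite !opprD /= scalerDr !scalerN addrACA.
Qed.

Lemma fib_diffK i j l (e : i + 1 = j) (e' : j + 1 = l) (p : fib_obj i) :
  fib_diff e' (fib_diff e p) = 0.
Proof.
rewrite /fib_diff /=; congr (_, _); first exact: diffK.
rewrite linearB linearN /= diffK subr0 opprK.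
by rewrite (diff_degcast _ (degS_pred e') e) cm_diff addNr.
Qed.

Definition Fib : cochain k := Cochain fib_diff_lin fib_diffK.

End Def.
End Fibre.

Record dgCat (k : comPzRingType) := DGCat {
  obj :> Type;
  hom : obj -> obj -> cochain k;
  comp : forall (X Y Z : obj) (i j l : int), i + j = l ->
    hom Y Z i -> hom X Y j -> hom X Z l;
  idm : forall X : obj, hom X X 0;
  comp_linr : forall X Y Z i j l (e : i + j = l) (g : hom Y Z i),
    linear (fun f : hom X Y j => comp e g f);
  comp_linl : forall X Y Z i j l (e : i + j = l) (f : hom X Y j),
    linear (fun g : hom Y Z i => comp e g f);
  comp_assoc : forall W X Y Z (i j l ij jl ijl : int)
    (e1 : i + j = ij) (e2 : j + l = jl) (e3 : ij + l = ijl) (e4 : i + jl = ijl)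
    (h : hom Y Z i) (g : hom X Y j) (f : hom W X l),
    comp e3 (comp e1 h g) f = comp e4 h (comp e2 g f);
  comp_id_l : forall X Y i (f : hom X Y i), comp (add0r i) (idm Y) f = f;
  comp_id_r : forall X Y i (f : hom X Y i), comp (addr0 i) f (idm X) = f;
  idm_cocycle : forall X, cocycle (idm X);
  leibniz : forall X Y Z (i j l i' j' l' : int)
    (e : i + j = l) (ei : i + 1 = i') (ej : j + 1 = j') (el : l + 1 = l')
    (e1 : i' + j = l') (e2 : i + j' = l') (g : hom Y Z i) (f : hom X Y j),
    diff el (comp e g f) =
      comp e1 (diff ei g) f + sgn i *: comp e2 g (diff ej f);
  (* Only non-positive DG-categories are considered. *)
  hom_nonpos : forall X Y (i : int) (f : hom X Y i), 0 < i -> f = 0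
}.
Arguments hom {k} d X Y.
Arguments comp {k d X Y Z i j l} e g f.
Arguments idm {k d} X.

Section Comp.
Variables (k : comPzRingType) (A : dgCat k).
Implicit Types X Y Z : A.

Definition precomp X Y Z i j l (e : i + j = l) (f : hom A X Y j) :=
  fun g : hom A Y Z i => comp e g f.

HB.instance Definition _ X Y Z i j l (e : i + j = l) (g : hom A Y Z i) :=
  GRing.isLinear.Build k (hom A X Y j) (hom A X Z l) _ (comp e g)
    (comp_linr e g).

HB.instance Definition _ X Y Z i j l (e : i + j = l) (f : hom A X Y j) :=
  GRing.isLinear.Build k (hom A Y Z i) (hom A X Z l) _ (precomp e f)
    (comp_linl e f).

Lemma compDl X Y Z i j l (e : i + j = l) (g g' : hom A Y Z i) (f : hom A X Y j) :
  comp e (g + g') f = comp e g f + comp e g' f.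
Proof. exact: (linearD (precomp e f)). Qed.

Lemma compNl X Y Z i j l (e : i + j = l) (g : hom A Y Z i) (f : hom A X Y j) :
  comp e (- g) f = - comp e g f.
Proof. exact: (linearN (precomp e f)). Qed.

Lemma compZl X Y Z i j l (e : i + j = l) a (g : hom A Y Z i) (f : hom A X Y j) :
  comp e (a *: g) f = a *: comp e g f.
Proof. exact: (linearZ_LR (precomp e f)). Qed.

Lemma comp0l X Y Z i j l (e : i + j = l) (f : hom A X Y j) :
  comp e (0 : hom A Y Z i) f = 0.
Proof. exact: (linear0 (precomp e f)). Qed.

Lemma cocycle_diff X Y i j (e : i + 1 = j) (f : hom A X Y i) :
  cocycle f -> diff e f = 0.
Proof. by case: j / e. Qed.

Lemma comp_cast X Y Z i j l l' (e : i + j = l) (e' : i + j = l') (el : l = l')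
    (g : hom A Y Z i) (f : hom A X Y j) :
  degcast el (comp e g f) = comp e' g f.
Proof. by case: l' / el e' => e'; rewrite (eq_irrelevance e' e). Qed.

End Comp.

Section Opposite.
Variables (k : comPzRingType) (A : dgCat k).

(* Koszul sign rule: g o^op f = (-1)^{|g||f|} f o g. *)
Definition op_comp (X Y Z : A) (i j l : int) (e : i + j = l)
    (g : hom A Z Y i) (f : hom A Y X j) : hom A Z X l :=
  sgn (i * j) *: comp (etrans (addrC j i) e) f g.

Lemma op_comp_linr (X Y Z : A) i j l (e : i + j = l) (g : hom A Z Y i) :
  linear (fun f : hom A Y X j => op_comp e g f).
Proof.
move=> a f f'; rewrite /op_comp compDl compZl scalerDr !scalerA.
by rewrite [_ * a]mulrC.
Qed.

Lemma op_comp_linl (X Y Z : A) i j l (e : i + j = l) (f : hom A Y X j) :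
  linear (fun g : hom A Z Y i => op_comp e g f).
Proof.
move=> a g g'; rewrite /op_comp linearP scalerDr !scalerA.
by rewrite [_ * a]mulrC.
Qed.

Lemma op_comp_assoc (W X Y Z : A) (i j l ij jl ijl : int)
    (e1 : i + j = ij) (e2 : j + l = jl) (e3 : ij + l = ijl) (e4 : i + jl = ijl)
    (h : hom A Z Y i) (g : hom A Y X j) (f : hom A X W l) :
  op_comp e3 (op_comp e1 h g) f = op_comp e4 h (op_comp e2 g f).
Proof.
rewrite /op_comp linearZ compZl !scalerA /=.
rewrite (comp_assoc _ (etrans (addrC j i) e1) _ (etrans (addrC l ij) e3)).
congr (_ *: _); rewrite -!sgnD -e1 -e2 mulrDl mulrDr; congr (sgn _).
by rewrite addrC addrA.
Qed.

Lemma op_comp_id_l (X Y : A) i (f : hom A Y X i) :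
  op_comp (add0r i) (idm Y) f = f.
Proof.
rewrite /op_comp mul0r sgn0 scale1r.
by rewrite (eq_irrelevance (etrans _ _) (addr0 i)) comp_id_r.
Qed.

Lemma op_comp_id_r (X Y : A) i (f : hom A Y X i) :
  op_comp (addr0 i) f (idm X) = f.
Proof.
rewrite /op_comp mulr0 sgn0 scale1r.
by rewrite (eq_irrelevance (etrans _ _) (add0r i)) comp_id_l.
Qed.

Lemma op_leibniz (X Y Z : A) (i j l i' j' l' : int)
    (e : i + j = l) (ei : i + 1 = i') (ej : j + 1 = j') (el : l + 1 = l')
    (e1 : i' + j = l') (e2 : i + j' = l') (g : hom A Z Y i) (f : hom A Y X j) :
  diff el (op_comp e g f) =
    op_comp e1 (diff ei g) f + sgn i *: op_comp e2 g (diff ej f).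
Proof.
rewrite /op_comp linearZ /=.
rewrite (leibniz _ ej ei el (etrans (addrC j' i) e2) (etrans (addrC j i') e1)).
have -> : sgn (i' * j) = sgn (i * j) * sgn j :> k.
  by rewrite -ei mulrDl mul1r sgnD.
have -> : sgn (i * j') = sgn (i * j) * sgn i :> k.
  by rewrite -ej mulrDr mulr1 sgnD.
by rewrite scalerDr !scalerA [LHS]addrC mulrCA sgn_sqr mulr1.
Qed.

Definition op : dgCat k :=
  @DGCat k A (fun X Y => hom A Y X) op_comp (fun X => idm X)
    op_comp_linr op_comp_linl op_comp_assoc op_comp_id_l op_comp_id_r
    (fun X => idm_cocycle X) op_leibniz
    (fun X Y i f => @hom_nonpos k A Y X i f).

End Opposite.

Section Definitions.
Variables (k : comPzRingType) (A : dgCat k).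
Implicit Types W X Y Z : A.

Definition degN1 : (-1 + 1 : int) = 0 := erefl.
Definition degN2 : (-2 + 1 : int) = -1 := erefl.

(* Closed morphisms of degree 0. *)
Record cmor X Y := CMor { mor :> hom A X Y 0; mor_closed : cocycle mor }.

Lemma postcomp_diff W X Y (f : cmor X Y) i j (e : i + 1 = j) (u : hom A W X i) :
  comp (add0r j) f (diff e u) = diff e (comp (add0r i) f u).
Proof.
have e1 : 0 + 1 + i = j by rewrite add0r addrC.
rewrite (leibniz _ (erefl (0 + 1)) e e e1 (add0r j)).
by rewrite (mor_closed f) comp0l add0r sgn0 scale1r.
Qed.

Definition postcomp_map W X Y (f : cmor X Y) : chain_map (hom A W X) (hom A W Y) :=
  ChainMap (fun i => comp_linr (add0r i) f) (postcomp_diff (W := W) f).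

Lemma precomp_diff X Y W (f : cmor X Y) i j (e : i + 1 = j) (u : hom A Y W i) :
  comp (addr0 j) (diff e u) f = diff e (comp (addr0 i) u f).
Proof.
have e2 : i + (0 + 1) = j by rewrite add0r.
rewrite (leibniz _ e (erefl (0 + 1)) e (addr0 j) e2).
by rewrite (mor_closed f) linear0 scaler0 addr0.
Qed.

Definition precomp_map X Y W (f : cmor X Y) : chain_map (hom A Y W) (hom A X W) :=
  ChainMap (fun i => comp_linl (addr0 i) f) (precomp_diff (W := W) f).

Definition is_mono (m : nat) X Y (f : cmor X Y) : Prop :=
  forall W, H_inj (postcomp_map W f) (- m%:Z + 1) /\
            (forall i : int, i <= - m%:Z -> H_bij (postcomp_map W f) i).

Definition homotopy_equivalence X Y (f : cmor X Y) : Prop :=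
  exists g : cmor Y X,
    cohomologous (comp (addr0 0) g f) (idm X) /\
    cohomologous (comp (addr0 0) f g) (idm Y).

(* Additivity of H^0(A), which is k-linear by construction: existence of a
   zero object and of binary biproducts. *)
Definition H0_zero_object Z : Prop :=
  forall W, (forall f g : cmor W Z, cohomologous (mor f) (mor g)) /\
            (forall f g : cmor Z W, cohomologous (mor f) (mor g)).

Definition H0_biproduct X Y S : Prop :=
  exists (iX : cmor X S) (iY : cmor Y S) (pX : cmor S X) (pY : cmor S Y),
    [/\ cohomologous (comp (addr0 0) pX iX) (idm X),
        cohomologous (comp (addr0 0) pY iY) (idm Y),
        cohomologous (comp (addr0 0) pX iY) 0,
        cohomologous (comp (addr0 0) pY iX) 0 &
        cohomologous (comp (addr0 0) iX pX + comp (addr0 0) iY pY) (idm S)].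

Definition H0_additive : Prop :=
  (exists Z, H0_zero_object Z) /\ (forall X Y, exists S, H0_biproduct X Y S).

Record hcomplex X Y Z := HComplex {
  hc_f : cmor X Y;
  hc_g : cmor Y Z;
  hc_h : hom A X Z (-1);
  hc_diff : diff degN1 hc_h = - comp (addr0 0) hc_g hc_f
}.

Section Exactness.
Variables (X Y Z : A) (c : hcomplex X Y Z).
Let f := hc_f c.
Let g := hc_g c.
Let h := hc_h c.

Definition ker_fun W (i : int) (u : hom A W X i) : Fib (postcomp_map W g) i :=
  (comp (add0r i) f u, comp (addrC (-1) i) h u).

Lemma ker_lin W i : linear (@ker_fun W i).
Proof. by move=> a u v; rewrite /ker_fun; congr (_, _); rewrite linearP. Qed.

Lemma ker_diff W i j (e : i + 1 = j) (u : hom A W X i) :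
  ker_fun (diff e u) = diff e (ker_fun u).
Proof.
rewrite /ker_fun /= /fib_diff /=; congr (_, _); first exact: postcomp_diff.
rewrite (leibniz _ degN1 e (degS_shift e)
  (etrans (add0r i) (degS_pred e)) (addrC (-1) j)).
rewrite hc_diff compNl [sgn _]expr1 scaleN1r opprD opprK opprK addrA /=.
rewrite (comp_cast _ (etrans (add0r i) (degS_pred e))).
by rewrite (comp_assoc _ (add0r i) _ (etrans (add0r i) (degS_pred e))) addNr add0r.
Qed.

Definition ker_map W : chain_map (hom A W X) (Fib (postcomp_map W g)) :=
  ChainMap (ker_lin (W := W)) (ker_diff (W := W)).

Definition left_exact : Prop :=
  forall W (i : int), i <= 0 -> H_bij (ker_map W) i.

Definition coker_fun W (i : int) (u : hom A Z W i) : Fib (precomp_map W f) i :=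
  (comp (addr0 i) u g, sgn i *: comp (erefl (i - 1)) u h).

Lemma coker_lin W i : linear (@coker_fun W i).
Proof.
move=> a u v; apply: (congr2 pair); rewrite /= compDl compZl //.
by rewrite scalerDr !scalerA mulrC.
Qed.

Lemma coker_diff W i j (e : i + 1 = j) (u : hom A Z W i) :
  coker_fun (diff e u) = diff e (coker_fun u).
Proof.
rewrite /coker_fun /= /fib_diff /=; congr (_, _); first exact: precomp_diff.
rewrite linearZ /=.
rewrite (leibniz _ e degN1 (degS_shift e)
  (erefl (j - 1)) (etrans (addr0 i) (degS_pred e))).
rewrite hc_diff linearN scalerDr scalerA sgn_sqr scale1r.
rewrite (comp_cast _ (etrans (addr0 i) (degS_pred e))).
rewrite (comp_assoc _ (addr0 0) _ (etrans (addr0 i) (degS_pred e))).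
have -> : sgn j = - sgn i :> k by rewrite -e sgnS.
by rewrite opprD opprK [RHS]addrC addrK scaleNr.
Qed.

Definition coker_map W : chain_map (hom A Z W) (Fib (precomp_map W f)) :=
  ChainMap (coker_lin (W := W)) (coker_diff (W := W)).

Definition right_exact : Prop :=
  forall W (i : int), i <= 0 -> H_bij (coker_map W) i.

Definition short_exact : Prop := left_exact /\ right_exact.

End Exactness.

Definition has_homotopy_kernel Y Z (g : cmor Y Z) : Prop :=
  exists X (c : hcomplex X Y Z), hc_g c = g /\ left_exact c.

Definition has_homotopy_cokernel X Y (f : cmor X Y) : Prop :=
  exists Z (c : hcomplex X Y Z), hc_f c = f /\ right_exact c.

Definition truncated (n : nat) : Prop :=
  forall X Y (i : int), i <= - n%:Z -> H_zero (hom A X Y) i.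

End Definitions.

Definition op_cmor k (A : dgCat k) (X Y : A) (f : cmor X Y) :
  @cmor k (op A) Y X := @CMor k (op A) Y X (mor f) (mor_closed f).

Definition is_epi (m : nat) k (A : dgCat k) (X Y : A) (f : cmor X Y) : Prop :=
  is_mono m (op_cmor f).

Record abelian_truncated (n : nat) k (A : dgCat k) : Prop := AbelianTruncated {
  at_truncated : truncated A n;
  at_additive : H0_additive A;
  at_kernel : forall (X Y : A) (f : cmor X Y), has_homotopy_kernel f;
  at_cokernel : forall (X Y : A) (f : cmor X Y), has_homotopy_cokernel f;
  at_mono : forall (X Y Z : A) (c : hcomplex X Y Z),
    right_exact c -> is_mono n (hc_f c) -> short_exact c;
  at_epi : forall (X Y Z : A) (c : hcomplex X Y Z),
    left_exact c -> is_epi n (hc_g c) -> short_exact c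
}.

Section Factorizations.
Variables (k : comPzRingType) (A : dgCat k) (X Y : A) (f : cmor X Y).

Record factorization := Factorization {
  fac_obj : A;
  fac_e : cmor X fac_obj;
  fac_m : cmor fac_obj Y;
  fac_eta : hom A X Y (-1);
  fac_diff : diff degN1 fac_eta
             = mor f - comp (addr0 0) fac_m fac_e
}.

Definition is_1n_factorization (n : nat) (F : factorization) : Prop :=
  is_epi 1 (fac_e F) /\ is_mono n (fac_m F).

Record fac_mor (F' F : factorization) := FacMor {
  fm_t : cmor (fac_obj F') (fac_obj F);
  fm_he : hom A X (fac_obj F) (-1);
  fm_hm : hom A (fac_obj F') Y (-1);
  fm_zeta : hom A X Y (-2);
  fm_he_diff : diff degN1 fm_he
               = mor (fac_e F) - comp (addr0 0) fm_t (fac_e F');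
  fm_hm_diff : diff degN1 fm_hm
               = mor (fac_m F') - comp (addr0 0) (fac_m F) fm_t;
  fm_zeta_diff : diff degN2 fm_zeta
               = - comp (addr0 (-1)) fm_hm (fac_e F') - fac_eta F'
                 + comp (add0r (-1)) (fac_m F) fm_he + fac_eta F
}.

Definition fac_equiv (F' F : factorization) : Prop :=
  exists phi : fac_mor F' F, homotopy_equivalence (fm_t phi).

End Factorizations.

(* Main.v *)
(* Existence.  Let q : Y -> C be a homotopy cokernel of f, m : I -> Y a homotopy
   kernel of q and e : X -> I the induced map, so that f ~ m e and m is an
   n-monomorphism; axiom (iii) makes (m, q) exact, so C is at once a cokernel of
   f and of m.  Let p : I -> P be a homotopy cokernel of e.  Comparing the two
   descriptions of C shows that H^i(P, W) = 0 for i < 0 and that a map P -> W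
   whose restriction along p extends along m is null.  Hence the square formed
   by m, p and P -> 0 -> C is a pushout: the sequence I -> Y (+) P -> C with maps
   (m, p) and (q, 0) is right exact.  As (m, p) is an n-monomorphism, axiom (ii)
   makes it left exact, so I, being the kernel of q, is also the kernel of
   (q, 0); this forces P = 0, that is, e is a 1-epimorphism.

   Uniqueness.  An n-monomorphism m is the kernel of its cokernel r, and maps out
   of a 1-epimorphism e' have acyclic fibres, so a second factorization m' e'
   lifts through m by a null-homotopy of r m' that is compatible with those of
   r m e.  Two such lifts are mutually inverse, as e' is homotopy epic. *)
Require Import Defs.
From HB Require Import structures.
From mathcomp Require Import all_boot all_order all_algebra.
From mathcomp Require Import zify.
(* Defs is imported again because the algebra library has its own [hom]. *)
Import Defs GRing.Theory.
Local Open Scope ring_scope.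
Set Implicit Arguments.
Unset Strict Implicit.
Unset Printing Implicit Defensive.

(** * Cochain complexes up to coboundaries *)

Section Complexes.
Variable k : comPzRingType.
Implicit Types C D M N : cochain k.

Definition coboundary C i (x : C i) := exists z, diff (subrK 1 i) z = x.

Lemma cocycleE C i (x : C i) j (e : i + 1 = j) : cocycle x <-> diff e x = 0.
Proof. by case: j / e. Qed.

Lemma diff_coboundary C i j (e : j + 1 = i) (z : C j) : coboundary (diff e z).
Proof.
exists (degcast (degS_pred e) z).
by rewrite (diff_degcast (degS_pred e) erefl e).
Qed.

Lemma coboundary_cocycle C i (x : C i) : coboundary x -> cocycle x.
Proof. by case=> z <-; exact: diffK. Qed.

Lemma coboundary0 C i : coboundary (0 : C i).
Proof. by exists 0; rewrite linear0. Qed.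

Lemma coboundaryD C i (x y : C i) :
  coboundary x -> coboundary y -> coboundary (x + y).
Proof. by case=> z <- [w <-]; exists (z + w); rewrite linearD. Qed.

Lemma coboundaryN C i (x : C i) : coboundary x -> coboundary (- x).
Proof. by case=> z <-; exists (- z); rewrite linearN. Qed.

Lemma coboundaryB C i (x y : C i) :
  coboundary x -> coboundary y -> coboundary (x - y).
Proof. by move=> ? /coboundaryN; exact: coboundaryD. Qed.

Lemma coboundaryZ C i a (x : C i) : coboundary x -> coboundary (a *: x).
Proof. by case=> z <-; exists (a *: z); rewrite linearZ. Qed.

Lemma cocycle0 C i : cocycle (0 : C i).
Proof. exact: linear0. Qed.

Lemma cocycleD C i (x y : C i) : cocycle x -> cocycle y -> cocycle (x + y).
Proof. by move=> cx cy; rewrite /cocycle linearD /= cx cy addr0. Qed.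

Lemma cocycleN C i (x : C i) : cocycle x -> cocycle (- x).
Proof. by move=> cx; rewrite /cocycle linearN /= cx oppr0. Qed.

Lemma cocycleB C i (x y : C i) : cocycle x -> cocycle y -> cocycle (x - y).
Proof. by move=> ? /cocycleN; exact: cocycleD. Qed.

Lemma cohomologous_sym C i (x y : C i) :
  cohomologous x y -> cohomologous y x.
Proof. by move=> /coboundaryN; rewrite opprB. Qed.

Lemma cohomologous_trans C i (y x z : C i) :
  cohomologous x y -> cohomologous y z -> cohomologous x z.
Proof. by move=> xy /(coboundaryD xy); rewrite addrA subrK. Qed.

Lemma cohomologous0 C i (x : C i) : cohomologous x 0 <-> coboundary x.
Proof. by rewrite -[x in coboundary x]subr0. Qed.

Lemma coboundary_cohomologous C i (x y : C i) :
  cohomologous x y -> coboundary y -> coboundary x.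
Proof. by move=> xy /(coboundaryD xy); rewrite subrK. Qed.

Lemma cmB C D (phi : chain_map C D) i (x y : C i) :
  phi i (x - y) = phi i x - phi i y.
Proof. exact: linearB. Qed.

Lemma cmN C D (phi : chain_map C D) i (x : C i) : phi i (- x) = - phi i x.
Proof. exact: linearN. Qed.

Lemma cm_cocycle C D (phi : chain_map C D) i (x : C i) :
  cocycle x -> cocycle (phi i x).
Proof. by move=> cx; rewrite /cocycle -cm_diff cx linear0. Qed.

Lemma cm_coboundary C D (phi : chain_map C D) i (x : C i) :
  coboundary x -> coboundary (phi i x).
Proof. by case=> z <-; exists (phi _ z); rewrite cm_diff. Qed.

Lemma cm_cohomologous C D (phi : chain_map C D) i (x y : C i) :
  cohomologous x y -> cohomologous (phi i x) (phi i y).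
Proof. by move=> /(cm_coboundary phi); rewrite linearB. Qed.

Lemma H_injP C D (phi : chain_map C D) i :
  H_inj phi i <->
  (forall x : C i, cocycle x -> coboundary (phi i x) -> coboundary x).
Proof.
split=> [inj x cx bx | inj x y cx cy].
  apply/cohomologous0; apply: inj => //; first exact: cocycle0.
  by rewrite linear0; apply/cohomologous0.
by move=> bxy; apply: inj; [exact: cocycleB | rewrite linearB].
Qed.

(** Injectivity gives some primitive [w] of [x]. Then [phi w - s] is a cocycle, and surjectivity one
    degree lower corrects [w] by a cocycle so that its image becomes the prescribed primitive [s] up
    to a coboundary. *)
Lemma H_lift_boundary C D (phi : chain_map C D) i (x : C i) (s : D (i - 1)) :
    H_inj phi i -> H_surj phi (i - 1) ->
    cocycle x -> diff (subrK 1 i) s = phi i x ->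
  exists w, diff (subrK 1 i) w = x /\ cohomologous (phi (i - 1) w) s.
Proof.
move=> /H_injP inj surj cx ds; have [|w dw] := inj x cx; first by exists s.
have cws : cocycle (phi (i - 1) w - s).
  by apply/(cocycleE _ (subrK 1 i)); rewrite linearB /= -cm_diff dw ds subrr.
have [v [cv vE]] := surj _ cws; exists (w - v); split.
  by rewrite linearB /= dw (proj1 (cocycleE v _) cv) subr0.
by move/coboundaryN: vE; rewrite opprB cmB /cohomologous addrAC.
Qed.

Section Factor.
Variables (C D E : cochain k) (i : int).
Variables (phi : chain_map C D) (psi : chain_map D E) (chi : chain_map C E).
Hypothesis chiE : forall x : C i, cocycle x ->
  cohomologous (chi i x) (psi i (phi i x)).

Lemma H_bij_comp : H_bij phi i -> H_bij psi i -> H_bij chi i.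
Proof.
move=> [/H_injP i1 s1] [/H_injP i2 s2]; split.
  apply/H_injP => x cx bx; apply: i1 => //; apply: i2; first exact: cm_cocycle.
  by apply: coboundary_cohomologous bx; apply/cohomologous_sym/chiE.
move=> z /s2[y [cy yz]]; have [x [cx xy]] := s1 _ cy; exists x; split=> //.
apply: (cohomologous_trans (chiE cx)); apply: cohomologous_trans yz.
exact: cm_cohomologous.
Qed.

Lemma H_bij_right : H_bij phi i -> H_bij chi i -> H_bij psi i.
Proof.
move=> [_ s1] [/H_injP i2 s2]; split.
  apply/H_injP => y cy by_; have [x [cx xy]] := s1 _ cy.
  apply: coboundary_cohomologous (cohomologous_sym xy) _.
  apply/cm_coboundary/i2 => //; apply: coboundary_cohomologous (chiE cx) _.
  by apply: coboundary_cohomologous (cm_cohomologous _ xy) _.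
move=> z /s2[x [cx xz]]; exists (phi i x); split; first exact: cm_cocycle.
exact: cohomologous_trans (cohomologous_sym (chiE cx)) xz.
Qed.

End Factor.

(** * Fibres of chain maps and their long exact sequence *)

Section Fibre.
Variables (M N : cochain k) (phi : chain_map M N).

Lemma fib_diffE i j (e : i + 1 = j) (p : Fib phi i) :
  diff e p = (diff e p.1,
    - degcast (degS_pred e) (phi i p.1 + diff (subrK 1 i) p.2)).
Proof.
rewrite /= /fib_diff linearD opprD; congr (_, _ - _).
exact: (diff_degcast erefl (degS_pred e) (subrK 1 i)).
Qed.

Lemma fib_cocycle i (p : Fib phi i) :
  cocycle p <-> cocycle p.1 /\ diff (subrK 1 i) p.2 = - phi i p.1.
Proof.
rewrite /cocycle fib_diffE; split.
  case=> -> /eqP; rewrite oppr_eq0 => /eqP h; split=> //.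
  apply/eqP; rewrite -addr_eq0 addrC; apply/eqP.
  by move: (degS_pred _) h => e; move: (phi i _ + _); case: _ / e.
by case=> -> ->; rewrite addrN linear0 oppr0.
Qed.

Lemma fib_diff_pred i (x : M (i - 1)) y :
  diff (subrK 1 i) ((x, y) : Fib phi (i - 1)) =
  (diff (subrK 1 i) x, - phi (i - 1) x - diff (subrK 1 (i - 1)) y).
Proof. by rewrite fib_diffE (eq_irrelevance (degS_pred _) erefl) /= opprD. Qed.

Lemma fib_coboundary i (p : Fib phi i) :
  coboundary p <-> exists x y, diff (subrK 1 i) x = p.1 /\
                     - phi (i - 1) x - diff (subrK 1 (i - 1)) y = p.2.
Proof.
split=> [[[x y]] | [x [y [xp yp]]]].
  by rewrite fib_diff_pred => <-; exists x, y.
by exists (x, y); rewrite fib_diff_pred xp yp; case: (p).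
Qed.

Lemma fib_lift i (x : M i) :
  cocycle x -> coboundary (phi i x) ->
  exists h, cocycle ((x, h) : Fib phi i).
Proof.
move=> cx [z zE]; exists (- z); apply/fib_cocycle; split=> //=.
by rewrite linearN /= zE.
Qed.

Lemma fib_fst_cohomologous i (p q : Fib phi i) :
  cohomologous p q -> cohomologous p.1 q.1.
Proof. by move=> /fib_coboundary[x [y [xE _]]]; exists x. Qed.

Lemma fib_fst_coboundary i (p : Fib phi i) : coboundary p -> coboundary p.1.
Proof. by move=> /fib_coboundary[x [y [xE _]]]; exists x. Qed.

Lemma fib_fst_null i (p : Fib phi i) : cocycle p -> coboundary (phi i p.1).
Proof.
by case/fib_cocycle => _ dp; exists (- p.2); rewrite linearN /= dp opprK.
Qed.

Lemma fib_cocycle0 i (h : N (i - 1)) :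
  cocycle ((0, h) : Fib phi i) <-> cocycle h.
Proof.
split=> [/fib_cocycle[_] | ch].
  by rewrite /= linear0 oppr0 => /cocycleE.
by apply/fib_cocycle; split; rewrite /= ?linear0 ?oppr0;
  [exact: cocycle0 | apply/cocycleE].
Qed.

(** Exactness of H^(i-1)(M) -> H^(i-1)(N) -> H^i(Fib) at the middle term. *)
Lemma fib_coboundary0 i (h : N (i - 1)) :
  coboundary ((0, h) : Fib phi i) <->
  exists x, cocycle x /\ coboundary (h + phi (i - 1) x).
Proof.
split=> [/fib_coboundary[x [y [/= /cocycleE cx <-]]] | [x [/cocycleE cx [y yE]]]].
  exists x; split=> //; rewrite (addrAC (- phi _ x)) addNr add0r.
  exact/coboundaryN/diff_coboundary.
apply/fib_coboundary; exists x, (- y); split; first exact: cx.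
by rewrite /= linearN opprK /= yE (addrC (- _)) addrK.
Qed.

(** Exactness of H^(i-1)(N) -> H^i(Fib) -> H^i(M) at the middle term: with [x] a primitive of [p.1],
    subtracting the boundary of [(x, 0)] clears the first component. *)
Lemma fib_reduce i (p : Fib phi i) :
  cocycle p -> coboundary p.1 ->
  exists h, cocycle h /\ cohomologous p (0, h).
Proof.
move=> cp [x xE].
have cb : cohomologous p ((0, p.2 + phi (i - 1) x) : Fib phi i).
  apply/fib_coboundary; exists x, 0; split; first by rewrite xE /= subr0.
  by rewrite linear0 subr0 /= opprD addrA subrr add0r.
exists (p.2 + phi (i - 1) x); split=> //.
apply/fib_cocycle0; have := cocycleB cp (coboundary_cocycle cb).
by rewrite opprB addrC subrK.
Qed.

End Fibre.

(** * Maps between fibres: a five lemma and an octahedral argument *)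

Section FibreMaps.
Variables (M N T L : cochain k) (a : chain_map M N).

Section FiveLemma.
Variables (c : chain_map T N) (alpha : chain_map M T).
Variable G : chain_map (Fib a) (Fib c).
Hypothesis G1 : forall i p, (G i p).1 = alpha i p.1.
Hypothesis G0 : forall i h, G i (0, h) = (0, h).

(* A five lemma for maps of fibres that are the identity on the target part. *)
Lemma fib_map_bij i :
    (forall x, cocycle x -> coboundary (alpha i x) -> coboundary x) ->
    (forall z, cocycle z -> coboundary (c i z) ->
       exists x, [/\ cocycle x, coboundary (a i x) & cohomologous (alpha i x) z]) ->
    (forall z, cocycle z ->
       exists x, cocycle x /\ cohomologous (a (i - 1) x) (c (i - 1) z)) ->
  H_bij G i.
Proof.
move=> inj surj surj'; split.
  apply/H_injP => p cp bGp.
  have bp1 : coboundary p.1.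
    apply: inj; first by case/fib_cocycle: cp.
    by rewrite -G1; exact: fib_fst_coboundary.
  have [h [ch ph]] := fib_reduce cp bp1.
  apply: (coboundary_cohomologous ph).
  have := coboundary_cohomologous (cohomologous_sym (cm_cohomologous G ph)) bGp.
  rewrite G0 => /fib_coboundary0[z [cz bz]].
  have [x [cx xz]] := surj' z cz; apply/fib_coboundary0; exists x; split=> //.
  by rewrite -(subrK (c (i - 1) z) (a _ x)) addrCA; exact: coboundaryD.
move=> q cq.
have [x [cx bax xq]] := surj q.1 (proj1 (proj1 (fib_cocycle q) cq)) (fib_fst_null cq).
have [h cp] := fib_lift cx bax.
have cd : cocycle (G i (x, h) - q) by apply: cocycleB cq; exact: cm_cocycle.
have bd1 : coboundary (G i (x, h) - q).1 by rewrite /= G1.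
have [h' [ch' dh']] := fib_reduce cd bd1.
exists ((x, h) - (0, h')); split; first by apply: cocycleB => //; exact/fib_cocycle0.
by rewrite /cohomologous cmB G0 addrAC.
Qed.

End FiveLemma.

(* When Fib a -> Fib c is an isomorphism in non-positive degrees, the connecting
   map H^i(Fib b) -> H^(i+1)(Fib a) is injective for i <= 0 and zero for i < 0.
   Its value at p is the class of (0, p.1), which is null iff p.1 ~ a x. *)
Section Octahedron.
Variables (b : chain_map N L) (c : chain_map M L).
Variable G : chain_map (Fib a) (Fib c).
Hypothesis cE : forall i x, cocycle x -> cohomologous (c i x) (b i (a i x)).
Hypothesis G1 : forall i p, (G i p).1 = p.1.
Hypothesis G0 : forall i h, G i (0, h) = (0, b (i - 1) h).

Lemma octahedron_inj i (p : Fib b i) x :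
    H_surj G i -> cocycle p -> cocycle x -> cohomologous (a i x) p.1 ->
  coboundary p.
Proof.
move=> surj cp cx xp.
(* First [p.1] is shown to be null: [x] lifts to a cocycle of [Fib c], hence up to homotopy to one
   of [Fib a], so [a x] is null. *)
have bcx : coboundary (c i x).
  apply: coboundary_cohomologous (cE cx) _.
  apply: coboundary_cohomologous (cm_cohomologous b xp) _.
  exact: fib_fst_null.
have [h ch] := fib_lift cx bcx; have [q [cq qx]] := surj _ ch.
have qx1 : cohomologous q.1 x by move: (fib_fst_cohomologous qx); rewrite G1.
have bp1 : coboundary p.1.
  apply: coboundary_cohomologous (cohomologous_sym xp) _.
  apply: coboundary_cohomologous (cm_cohomologous a (cohomologous_sym qx1)) _.
  exact: fib_fst_null.
have [l [cl pl]] := fib_reduce cp bp1; apply: coboundary_cohomologous pl _.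
(* Surjectivity is used a second time, on [(0, l)]. The preimage reduces to some [(0, n)], so [l]
   agrees with [b n] up to the image of [c], which factors through [b]; hence [(0, l)] is null in
   [Fib b]. *)
have [r [cr rl]] := surj _ (proj2 (fib_cocycle0 c l) cl).
have br1 : coboundary r.1.
  by move: (fib_fst_cohomologous rl); rewrite G1 /= => /cohomologous0.
have [n [cn rn]] := fib_reduce cr br1.
have := cohomologous_trans (cohomologous_sym rl) (cm_cohomologous G rn).
have -> : G i (0, n) = (0, b (i - 1) n) by exact: G0.
have E : ((0, l) : Fib c i) - (0, b (i - 1) n) = (0, l - b (i - 1) n).
  by congr (_, _); rewrite /= subr0.
rewrite /cohomologous -/(coboundary _) E => /fib_coboundary0[w [cw bw]].
apply/fib_coboundary0; exists (a (i - 1) w - n).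
split; first by apply: cocycleB => //; exact: cm_cocycle.
have := coboundaryB bw (cE cw).
by rewrite opprB addrACA subrr addr0 addrAC -addrA -cmB.
Qed.

Lemma octahedron_lift i (p : Fib b (i - 1)) :
  H_inj G i -> cocycle p ->
  exists x, cocycle x /\ cohomologous (a (i - 1) x) p.1.
Proof.
move=> /H_injP inj cp.
have cp1 : cocycle p.1 by case/fib_cocycle: cp.
have b0 : coboundary (G i (0, p.1)).
  rewrite G0; apply/fib_coboundary0; exists 0; split; first exact: cocycle0.
  by rewrite linear0 addr0; exact: fib_fst_null.
have /fib_coboundary0[x [cx bx]] := inj _ (proj2 (fib_cocycle0 a p.1) cp1) b0.
exists (- x); split; first exact: cocycleN.
by move/coboundaryN: bx; rewrite opprD (addrC (- p.1)) -cmN.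
Qed.

End Octahedron.
End FibreMaps.
End Complexes.

Local Notation "g ∘ f" := (comp (addr0 _) g f) (at level 40, left associativity).
Local Notation "g ∘l f" := (comp (add0r _) g f) (at level 40, left associativity).

(** * Composition in a DG-category and homotopy commutative squares *)

Section DGCategories.
Variables (k : comPzRingType) (A : dgCat k).
Implicit Types W X Y Z : A.

Lemma compE X Y Z i j l (e e' : i + j = l) (g : hom A Y Z i) (f : hom A X Y j) :
  comp e g f = comp e' g f.
Proof. by rewrite (eq_irrelevance e e'). Qed.

Lemma comp_rr W X Y Z i (u : hom A Y Z i) (g : hom A X Y 0) (f : hom A W X 0) :
  u ∘ g ∘ f = u ∘ (g ∘ f).
Proof. exact: comp_assoc. Qed.

Lemma comp_ll W X Y Z i (h : hom A Y Z 0) (g : hom A X Y 0) (u : hom A W X i) :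
  h ∘ g ∘l u = h ∘l (g ∘l u).
Proof. exact: comp_assoc. Qed.

Lemma comp_lr W X Y Z i (g : hom A Y Z 0) (u : hom A X Y i) (f : hom A W X 0) :
  g ∘l u ∘ f = g ∘l (u ∘ f).
Proof. exact: comp_assoc. Qed.

Lemma compBl X Y Z i j l (e : i + j = l) (g g' : hom A Y Z i) (f : hom A X Y j) :
  comp e (g - g') f = comp e g f - comp e g' f.
Proof. by rewrite compDl compNl. Qed.

Lemma compDr X Y Z i j l (e : i + j = l) (g : hom A Y Z i) (f f' : hom A X Y j) :
  comp e g (f + f') = comp e g f + comp e g f'.
Proof. exact: linearD. Qed.

Lemma compBr X Y Z i j l (e : i + j = l) (g : hom A Y Z i) (f f' : hom A X Y j) :
  comp e g (f - f') = comp e g f - comp e g f'.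
Proof. exact: linearB. Qed.

Lemma compNr X Y Z i j l (e : i + j = l) (g : hom A Y Z i) (f : hom A X Y j) :
  comp e g (- f) = - comp e g f.
Proof. exact: linearN. Qed.

Lemma diff_comp_r X Y Z i j (e : i + 1 = j) (u : hom A Y Z i) (f : cmor X Y) :
  diff e (u ∘ f) = diff e u ∘ f.
Proof. exact/esym/precomp_diff. Qed.

Lemma diff_comp_l X Y Z i j (e : i + 1 = j) (g : cmor Y Z) (u : hom A X Y i) :
  diff e (g ∘l u) = g ∘l diff e u.
Proof. exact/esym/postcomp_diff. Qed.

Lemma ccomp_closed X Y Z (g : cmor Y Z) (f : cmor X Y) : cocycle (mor g ∘ mor f).
Proof. by rewrite /cocycle diff_comp_r (mor_closed g) comp0l. Qed.

Definition ccomp X Y Z (g : cmor Y Z) (f : cmor X Y) : cmor X Z :=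
  CMor (ccomp_closed g f).

Definition cid X : cmor X X := CMor (idm_cocycle X).

Lemma comp_coboundary_r X Y Z i j l (e : i + j = l) (u : hom A Y Z i)
    (v : hom A X Y j) :
  cocycle u -> coboundary v -> coboundary (comp e u v).
Proof.
move=> cu [z <-]; have e1 : i + (j - 1) = l - 1 by rewrite addrA e.
have e2 : i + 1 + (j - 1) = l by rewrite addrAC e1 subrK.
have -> : comp e u (diff (subrK 1 j) z) =
    sgn i *: diff (subrK 1 l) (comp e1 u z).
  rewrite (leibniz e1 erefl (subrK 1 j) (subrK 1 l) e2 e) cu comp0l add0r.
  by rewrite scalerA sgn_sqr scale1r.
exact/coboundaryZ/diff_coboundary.
Qed.

Lemma coboundary_idm_l X i W (u : hom A X W i) :
  coboundary (idm X) -> cocycle u -> coboundary u.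
Proof. by move=> b cu; rewrite -(comp_id_r u); exact: comp_coboundary_r. Qed.

Section Square.
Variables (X0 X1 Y0 Y1 : A) (x0 : cmor X0 Y0) (x1 : cmor X1 Y1).
Variables (e : cmor X1 X0) (r : cmor Y1 Y0) (kappa : hom A X1 Y0 (-1)).
Hypothesis dkappa : diff degN1 kappa = mor x0 ∘ mor e - mor r ∘ mor x1.

(* The map of fibres induced by the homotopy commutative square x0 e ~ r x1. *)
Definition square_fun W (i : int) (p : Fib (precomp_map W x0) i) :
    Fib (precomp_map W x1) i :=
  (p.1 ∘ r, p.2 ∘ e + sgn i *: comp (erefl (i - 1)) p.1 kappa).

Lemma square_lin W i : linear (@square_fun W i).
Proof.
move=> a [u v] [u' v']; rewrite /square_fun /=; apply: (congr2 pair).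
  by rewrite compDl compZl.
rewrite !compDl !compZl /= !scalerDr !scalerA [sgn i * a]mulrC.
by rewrite addrACA.
Qed.

Lemma degcast_comp_r X Y Z i j (E : i = j) (u : hom A Y Z i) (f : hom A X Y 0) :
  degcast E u ∘ f = degcast E (u ∘ f).
Proof. by case: j / E. Qed.

Lemma square_diff W i j (E : i + 1 = j) (p : Fib (precomp_map W x0) i) :
  square_fun (diff E p) = diff E (square_fun p).
Proof.
rewrite /square_fun /= /fib_diff /=; congr (_, _); first by rewrite diff_comp_r.
rewrite [in RHS]linearD linearZ /= diff_comp_r.
rewrite (leibniz _ E degN1 (degS_shift E)
  (erefl (j - 1)) (etrans (addr0 i) (degS_pred E))).
rewrite dkappa -(comp_cast (addr0 i) _ (degS_pred E)) compBr.
rewrite -!comp_rr linearB /= scalerDr scalerA sgn_sqr scale1r.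
rewrite compBl compNl degcast_comp_r.
have -> : sgn j = - sgn i :> k by rewrite -E sgnS.
rewrite scaleNr !opprD opprK !addrA.
by rewrite [RHS]addrC !addrA addrN add0r [RHS]addrC addrA.
Qed.

Definition square_map W :
    chain_map (Fib (precomp_map W x0)) (Fib (precomp_map W x1)) :=
  ChainMap (square_lin (W := W)) (square_diff (W := W)).

End Square.

(** This makes two-out-of-three available for comparing cokernel descriptions of the same [Z]. The
    two sides have equal first components, and their second components differ by [u] composed with a
    coboundary. *)
Lemma square_coker X0 X1 Y0 Y1 Z (c : hcomplex X0 Y0 Z) (c' : hcomplex X1 Y1 Z)
    (e : cmor X1 X0) (r : cmor Y1 Y0) (kappa : hom A X1 Y0 (-1))
    (dkappa : diff degN1 kappa = mor (hc_f c) ∘ mor e - mor r ∘ mor (hc_f c')) W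
    i (u : hom A Z W i) :
    mor (hc_g c') = mor (hc_g c) ∘ mor r ->
    cohomologous (hc_h c') (hc_h c ∘ mor e + mor (hc_g c) ∘l kappa) ->
    cocycle u ->
  cohomologous (coker_map c' W i u) (square_map dkappa W i (coker_map c W i u)).
Proof.
move=> gE hE cu; rewrite /= /coker_fun /square_fun /= gE.
have -> : sgn i *: comp erefl u (hc_h c) ∘ e +
    sgn i *: comp (erefl (i - 1)) (u ∘ hc_g c) kappa =
    sgn i *: comp erefl u (hc_h c ∘ e + hc_g c ∘l kappa).
  rewrite compDr compZl scalerDr; congr (_ *: _ + _ *: _).
    exact: comp_assoc.
  exact: comp_assoc.
pose p : Fib (precomp_map W (hc_f c')) i := (0, sgn i *: comp (erefl (i - 1)) u
  (hc_h c' - (hc_h c ∘ e + hc_g c ∘l kappa))).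
suff bp : coboundary p.
  congr (coboundary _): bp; rewrite /p compBr scalerBr.
  by congr (_, _); rewrite /= comp_rr subrr.
apply/fib_coboundary0; exists 0; split; first exact: cocycle0.
rewrite linear0 addr0; apply: coboundaryZ; exact: comp_coboundary_r.
Qed.

(** In degrees at most -n all cohomology vanishes, so bijectivity there is automatic. *)
Lemma truncated_mono n X Y (f : cmor X Y) :
    truncated A n -> (forall W, H_inj (postcomp_map W f) (- n%:Z + 1)) ->
  is_mono n f.
Proof.
move=> trA inj W; split=> // i ni; split.
  by move=> x y cx cy _; apply/cohomologous0/trA => //; exact: cocycleB.
move=> y cy; exists 0; split; first exact: cocycle0.
by rewrite linear0; apply/cohomologous_sym/trA.
Qed.

End DGCategories.
Arguments cid {k A} X.

(** * Monomorphisms, epimorphisms and exact sequences *)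

Section Exactness.
Variables (k : comPzRingType) (A : dgCat k) (n : nat).
Implicit Types W X Y Z : A.

Lemma op_truncated : truncated A n -> truncated (op A) n.
Proof. by move=> trA X Y; apply: trA. Qed.

(** The Koszul sign is trivial because [g] has degree 0; epimorphisms can thus be tested by
    precomposition in [A] itself. *)
Lemma op_postcompE X Y W (g : cmor X Y) i (u : hom A Y W i) :
  postcomp_map (A := op A) W (op_cmor g) i u = precomp_map W g i u.
Proof. by rewrite /= /op_comp mul0r sgn0 scale1r; apply: compE. Qed.

Lemma op_postcomp_inj X Y W (g : cmor X Y) i :
  H_inj (postcomp_map (A := op A) W (op_cmor g)) i <-> H_inj (precomp_map W g) i.
Proof. by split=> h x y; move: (h x y); rewrite !op_postcompE. Qed.

Lemma op_postcomp_surj X Y W (g : cmor X Y) i :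
  H_surj (postcomp_map (A := op A) W (op_cmor g)) i <-> H_surj (precomp_map W g) i.
Proof.
by split=> h x cx; have [y hy] := h x cx; exists y; move: hy; rewrite op_postcompE.
Qed.

(** The kernel of H^i(Fib) -> H^i(M) is a quotient of H^(i-1)(N), which is assumed to vanish. *)
Lemma H_inj_fib (C M N : cochain k) (phi : chain_map M N)
    (theta : chain_map C (Fib phi)) (psi : chain_map C M) i :
    (forall x, (theta i x).1 = psi i x) ->
  H_inj theta i -> H_zero N (i - 1) -> H_inj psi i.
Proof.
move=> E /H_injP inj z; apply/H_injP => x cx bx; apply: inj => //.
have c1 : cocycle (theta i x) by exact: cm_cocycle.
rewrite -E in bx; have [h [ch hE]] := fib_reduce c1 bx.
apply: coboundary_cohomologous hE _; apply/fib_coboundary0; exists 0.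
by split; [exact: cocycle0 | rewrite linear0 addr0; apply/cohomologous0/z].
Qed.

Lemma left_exact_mono X Y Z (c : hcomplex X Y Z) :
  (0 < n)%N -> truncated A n -> left_exact c -> is_mono n (hc_f c).
Proof.
move=> n0 trA lex; apply: truncated_mono => // W.
have n1 : - n%:Z + 1 <= 0 by lia.
apply: (H_inj_fib (theta := ker_map c W)) => //; first exact: (lex W _ n1).1.
by apply: trA; lia.
Qed.

Lemma right_exact_epi X Y Z (c : hcomplex X Y Z) :
  (0 < n)%N -> truncated A n -> right_exact c -> is_epi n (hc_g c).
Proof.
move=> n0 trA rex; apply: truncated_mono => [|W]; first exact: op_truncated.
have n1 : - n%:Z + 1 <= 0 by lia.
apply/op_postcomp_inj.
apply: (H_inj_fib (theta := coker_map c W)) => //; first exact: (rex W _ n1).1.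
by apply: trA; lia.
Qed.

Lemma epi1P X Y (e : cmor X Y) :
  is_epi 1 e <-> forall W,
    [/\ forall i, i <= 0 -> H_inj (precomp_map W e) i &
        forall i, i <= -1 -> H_surj (precomp_map W e) i].
Proof.
split=> [epi W | epi W].
  have [i0 b] := epi W; split=> i le_i; last first.
    by apply/op_postcomp_surj; case: (b i le_i).
  apply/op_postcomp_inj; case: (eqVneq i 0) => [-> //|ne_i].
  by have /b[] : i <= -1 by lia.
have [inj surj] := epi W; split=> [|i le_i]; first exact/op_postcomp_inj/inj.
split; [apply/op_postcomp_inj/inj; lia | exact/op_postcomp_surj/surj].
Qed.

(** A null identity makes every cocycle out of [Z] null, so the fibres of precomposition with
    [hc_f c] are acyclic in non-positive degrees; the long exact sequence then gives the claim. *)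
Lemma coboundary_idm_epi1 X Y Z (c : hcomplex X Y Z) :
  right_exact c -> coboundary (idm Z) -> is_epi 1 (hc_f c).
Proof.
move=> rex bZ; apply/epi1P => W.
have fib0 i (p : Fib (precomp_map W (hc_f c)) i) :
    i <= 0 -> cocycle p -> coboundary p.
  move=> le_i cp; have [u [cu up]] := (rex W i le_i).2 p cp.
  apply: coboundary_cohomologous (cohomologous_sym up) _.
  exact/cm_coboundary/(coboundary_idm_l bZ).
split=> i le_i.
  apply/H_injP => x cx bx; have [h cp] := fib_lift cx bx.
  exact: (fib_fst_coboundary (fib0 _ _ le_i cp)).
(* A cocycle [y] of degree i enters the fibre as [(0, y)] in degree i + 1, so surjectivity is
   obtained only for i at most -1. *)
have le_i1 : i + 1 <= 0 by lia.
have e : i = i + 1 - 1 by rewrite addrK.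
suff : H_surj (precomp_map W (hc_f c)) (i + 1 - 1) by rewrite -e.
move=> y cy; have := fib0 _ _ le_i1 (proj2 (fib_cocycle0 (precomp_map W (hc_f c)) y) cy).
case/fib_coboundary0=> x [cx bx]; exists (- x); split; first exact: cocycleN.
by move/coboundaryN: bx; rewrite opprD (addrC (- y)) -cmN.
Qed.

Lemma comp_coboundary_l X Y Z i j l (e : i + j = l) (u : hom A Y Z i)
    (v : hom A X Y j) :
  coboundary u -> cocycle v -> coboundary (comp e u v).
Proof.
case=> z <- cv; have e1 : i - 1 + j = l - 1 by rewrite addrAC e.
have e2 : i - 1 + (j + 1) = l by rewrite addrA e1 subrK.
have -> : comp e (diff (subrK 1 i) z) v = diff (subrK 1 l) (comp e1 z v).
  rewrite (leibniz e1 (subrK 1 i) erefl (subrK 1 l) e e2) cv.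
  by rewrite linear0 scaler0 addr0.
exact: diff_coboundary.
Qed.

(** * Existence: the cokernel of the map to the image *)

Section ImageFactorization.
Variables X Y I C P : A.
Variables (c1 : hcomplex X Y C) (c2 : hcomplex I Y C) (c3 : hcomplex X I P).
Let f := hc_f c1.
Let m := hc_f c2.
Let q := hc_g c2.
Let e := hc_f c3.
Let p := hc_g c3.
Variable eta : hom A X Y (-1).
Hypothesis deta : diff degN1 eta = mor f - mor m ∘ mor e.
Hypothesis gE : mor (hc_g c1) = mor q.
Hypothesis hE : cohomologous (hc_h c1) (hc_h c2 ∘ mor e - mor q ∘l eta).
Hypotheses (rex1 : right_exact c1) (rex2 : right_exact c2).
Hypothesis rex3 : right_exact c3.

Lemma image_square_diff : diff degN1 (- eta) = mor m ∘ mor e - mor (cid Y) ∘ mor f.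
Proof.
rewrite linearN /= deta opprB; congr (_ - _).
by rewrite -[LHS]comp_id_l; exact: compE.
Qed.

Let G := square_map image_square_diff.

(** Two-out-of-three: [C] is a cokernel of both [m] and [f], and [G] relates the two comparison maps
    up to homotopy. *)
Lemma image_square_bij W i : i <= 0 -> H_bij (G W) i.
Proof.
move=> le_i; apply: (H_bij_right _ (rex2 W le_i) (rex1 W le_i)) => u cu.
apply: square_coker => //; first by rewrite comp_id_r gE.
by rewrite compNr.
Qed.

Lemma image_square0 W i h : G W i (0, h) = (0, precomp_map W e (i - 1) h).
Proof. by rewrite /= /square_fun /= comp_id_r comp0l scaler0 addr0. Qed.

(** The octahedral argument is applied to precomposition with [m], [e] and [f]: it shows that the
    cocycle of the fibre of [e] corresponding to [phi] is null, and [P] being the cokernel of [e]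
    gives [phi] null. *)
Lemma image_coker_inj W i (phi : hom A P W i) (psi : hom A Y W i) :
  i <= 0 -> cocycle phi -> cocycle psi ->
  cohomologous (psi ∘ mor m) (phi ∘ mor p) -> coboundary phi.
Proof.
move=> le_i cphi cpsi E; have /H_injP inj := (rex3 W le_i).1; apply: inj => //.
have cE j (x : hom A Y W j) : cocycle x ->
    cohomologous (precomp_map W f j x) (precomp_map W e j (precomp_map W m j x)).
  move=> cx; rewrite /= comp_rr /cohomologous -compBr -deta.
  exact: comp_coboundary_r (diff_coboundary _ _).
have G1 j r : (G W j r).1 = r.1 by rewrite /= comp_id_r.
have surj := (image_square_bij W le_i).2.
have cp := cm_cocycle (coker_map c3 W) cphi.
exact: (octahedron_inj cE G1 (@image_square0 W) surj cp cpsi E).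
Qed.

(** In negative degrees the restriction of [phi] along [p] always extends along [m], so the previous
    criterion applies. *)
Lemma image_coker_acyclic W i (phi : hom A P W (i - 1)) :
  i <= 0 -> cocycle phi -> coboundary phi.
Proof.
move=> le_i cphi.
have inj := (image_square_bij W le_i).1.
have cp := cm_cocycle (coker_map c3 W) cphi.
have [psi [cpsi E]] := octahedron_lift (@image_square0 W) inj cp.
by apply: image_coker_inj cphi cpsi E; lia.
Qed.


(** * Existence: the pushout sequence I -> Y (+) P -> C *)

Section Pushout.
Variable S : A.
Variables (iY : cmor Y S) (iP : cmor P S) (pY : cmor S Y) (pP : cmor S P).
Hypothesis pP_iP : cohomologous (mor pP ∘ mor iP) (idm P).
Hypothesis iY_pY : cohomologous (mor iY ∘ mor pY + mor iP ∘ mor pP) (idm S).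
Variables (alpha : hom A Y Y (-1)) (beta : hom A P Y (-1)).
Hypothesis dalpha : diff degN1 alpha = mor pY ∘ mor iY - idm Y.
Hypothesis dbeta : diff degN1 beta = mor pY ∘ mor iP.

Let pushout_mor : hom A I S 0 := mor iY ∘ mor m + mor iP ∘ mor p.

Lemma pushout_mor_closed : cocycle pushout_mor.
Proof. by apply: cocycleD; apply: ccomp_closed. Qed.

Let j := CMor pushout_mor_closed.

(** A homotopy between [m] and the [Y]-component [pY ∘ j]; it is needed because the biproduct
    relations hold only up to homotopy. *)
Let kappa : hom A I Y (-1) := - (alpha ∘ mor m + beta ∘ mor p).

Lemma pushout_square_diff : diff degN1 kappa = mor m ∘ mor (cid I) - mor pY ∘ mor j.
Proof.
rewrite linearN linearD /= !diff_comp_r dalpha dbeta compBl !comp_rr.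
rewrite comp_id_r /pushout_mor compDr !opprD opprK addrA (addrC (- _)).
by congr (_ - _ - _); rewrite -[RHS]comp_id_l; exact: compE.
Qed.

Lemma pushout_hcomplex_diff :
  diff degN1 (hc_h c2 + mor q ∘l kappa) = - (mor (ccomp q pY) ∘ mor j).
Proof.
rewrite linearD /= diff_comp_l pushout_square_diff hc_diff comp_id_r compBr.
by rewrite (compE _ (addr0 0)) addrA addNr add0r (compE _ (addr0 0)) -comp_rr.
Qed.

Let c4 := HComplex pushout_hcomplex_diff.

Let H := square_map pushout_square_diff.

(** By the five lemma it suffices to compare cocycles on [Y] with cocycles on [S], and the two
    results on maps out of [P] remove the [P]-component. *)
Lemma pushout_square_bij W i : i <= 0 -> H_bij (H W) i.
Proof.
move=> le_i.
have cj l (z : hom A S W l) : z ∘ mor j = z ∘ mor iY ∘ mor m + z ∘ mor iP ∘ mor p.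
  by rewrite compDr !comp_rr.
apply: (fib_map_bij (alpha := precomp_map W pY)).
- by [].
- move=> l h; rewrite /= /square_fun /= comp_id_r !comp0l.
  by rewrite scaler0 addr0.
- move=> x cx bx; rewrite -(comp_id_r x) -[comp _ _ _](subrK (x ∘ (mor pY ∘ mor iY))).
  apply: coboundaryD.
    rewrite -compBr; apply: comp_coboundary_r => //; rewrite -opprB -dalpha.
    exact/coboundaryN/diff_coboundary.
  by rewrite -comp_rr; exact: (cm_coboundary (precomp_map W iY) bx).
- move=> z cz bz.
  have cY : cocycle (z ∘ mor iY) by exact: (cm_cocycle (precomp_map W iY) cz).
  have cP : cocycle (z ∘ mor iP) by exact: (cm_cocycle (precomp_map W iP) cz).
  have bP : coboundary (z ∘ mor iP).
    (* As [z ∘ j] is null, the restriction of [z ∘ iP] along [p] is homotopic to that of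
       [- (z ∘ iY)] along [m]. *)
    apply: (image_coker_inj le_i cP (cocycleN cY)).
    rewrite compNl /cohomologous -opprD -cj; exact: coboundaryN.
  exists (z ∘ mor iY); split=> //.
    have -> : precomp_map W m i (z ∘ mor iY) = z ∘ mor j - z ∘ mor iP ∘ mor p.
      by rewrite cj addrK.
    exact: coboundaryB bz (cm_coboundary (precomp_map W p) bP).
  have := coboundaryB (comp_coboundary_r (addr0 i) cz iY_pY)
    (cm_coboundary (precomp_map W pP) bP).
  rewrite compBr comp_id_r compDr /= -!comp_rr addrAC addrK.
  by [].
move=> z cz; exists (z ∘ mor iY); split.
  exact: (cm_cocycle (precomp_map W iY) cz).
rewrite /cohomologous /= cj opprD addrA addrN add0r.
apply/coboundaryN/(cm_coboundary (precomp_map W p)).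
apply: (image_coker_acyclic le_i).
exact: (cm_cocycle (precomp_map W iP) cz).
Qed.

Lemma pushout_right_exact : right_exact c4.
Proof.
move=> W i le_i; apply: H_bij_comp (rex2 W le_i) (pushout_square_bij W le_i).
move=> u cu; apply: (square_coker (c := c2) (c' := c4) pushout_square_diff) => //.
rewrite comp_id_r /cohomologous subrr; exact: coboundary0.
Qed.

(** If [j u] is null then so is [m u], since [m] is homotopic to [pY ∘ j]. *)
Lemma pushout_mono : truncated A n -> is_mono n m -> is_mono n j.
Proof.
move=> trA mono_m; apply: truncated_mono => // W; apply/H_injP => u cu bu.
have /H_injP inj := (mono_m W).1; apply: inj => //.
have := coboundaryD (cm_coboundary (postcomp_map W pY) bu)
  (comp_coboundary_l (add0r _) (diff_coboundary degN1 kappa) cu).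
by rewrite pushout_square_diff comp_id_r compBl /= -comp_ll (addrC (_ ∘l u)) subrK.
Qed.

(** The inclusion [iP] is killed by [q ∘ pY], so it factors as [j x] up to homotopy. Its
    [Y]-component is null, compatibly with the homotopies into [C], so [x] is null because [I] is
    the kernel of [q]. Hence [iP] is null, and so is [pP ∘ iP], which is homotopic to the
    identity. *)
Lemma pushout_coker_zero : left_exact c2 -> left_exact c4 -> coboundary (idm P).
Proof.
move=> lex2 lex4.
have cy : cocycle ((mor iP, - (mor q ∘l beta)) : Fib (postcomp_map P (ccomp q pY)) 0).
  apply/fib_cocycle; split; first exact: mor_closed.
  rewrite /= (eq_irrelevance (subrK 1 0) degN1) linearN /= diff_comp_l dbeta.
  by rewrite (compE _ (addr0 0)) (compE (add0r 0) (addr0 0)) comp_rr.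
have [x [cx /fib_coboundary[z1 [z2 [E1 E2]]]]] := (lex4 P 0 isT).2 _ cy.
pose w : hom A P S (-1) := z1; pose xc := CMor cx.
have dw : diff degN1 w = mor j ∘ mor xc - mor iP.
  rewrite (eq_irrelevance degN1 (subrK 1 0)); apply: etrans E1 _.
  by congr (_ - _); apply: compE.
have dkx : diff degN1 (kappa ∘ x) = mor m ∘ x - mor pY ∘ mor j ∘ x.
  by rewrite (diff_comp_r degN1 kappa xc) pushout_square_diff comp_id_r compBl.
have bx : coboundary x.
  have /H_injP inj := (lex2 P 0 isT).1; apply: inj => //.
  (* The three terms are homotopies along [m x ~ pY j x ~ pY iP ~ 0]; their differentials telescope
     to [m x]. *)
  apply/fib_coboundary; exists (mor pY ∘l w + kappa ∘ x + beta), z2; split.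
    rewrite (eq_irrelevance (subrK 1 0) degN1) !linearD /= diff_comp_l.
    rewrite dw dkx dbeta compBr.
    by rewrite !(compE (add0r 0) (addr0 0)) -comp_rr addrAC subrK addrC subrK.
  have {}E2 : - (mor q ∘ mor pY ∘l w) - diff (subrK 1 (0 - 1)) z2 =
      (hc_h c2 + mor q ∘l kappa) ∘ x + mor q ∘l beta.
    apply: etrans E2 _; rewrite /= opprK; congr (_ + _); exact: compE.
  have -> : postcomp_map P (hc_g c2) (0 - 1) (mor pY ∘l w + kappa ∘ x + beta) =
      mor q ∘ mor pY ∘l w + mor q ∘l kappa ∘ x + mor q ∘l beta.
    by rewrite comp_ll comp_lr -!compDr.
  rewrite !opprD addrAC [X in X - _ = _]addrAC E2 compDl.
  rewrite addrAC addrK addrK; exact: compE.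
have bi : coboundary (mor iP).
  have := coboundaryB (cm_coboundary (postcomp_map P j) bx) (diff_coboundary degN1 w).
  by rewrite dw /= (compE _ (addr0 0)) opprB addrA addrAC subrr add0r.
apply: coboundary_cohomologous (cohomologous_sym pP_iP) _.
by rewrite (compE _ (add0r 0)); exact: (cm_coboundary (postcomp_map P pP) bi).
Qed.

End Pushout.
End ImageFactorization.

Lemma image_factorization_exists X Y (f : cmor X Y) :
  (0 < n)%N -> abelian_truncated n A ->
  exists F : factorization f, is_1n_factorization n F.
Proof.
move=> n0 hA; have trA := at_truncated hA.
have [C [c1 [fE rex1]]] := at_cokernel hA f; subst f.
have [I [c2 [gE lex2]]] := at_kernel hA (hc_g c1).
(* Axiom (iii) applies because a homotopy cokernel map is an n-epimorphism. *)
have [_ rex2] : short_exact c2.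
  by apply: (at_epi hA) => //; rewrite gE; exact: right_exact_epi.
(* Lifting [f] together with its null-homotopy, rather than [f] alone, also yields the compatibility
   [hE] of homotopies below. *)
have cf : cocycle ((mor (hc_f c1), hc_h c1) : Fib (postcomp_map X (hc_g c2)) 0).
  apply/fib_cocycle; split; first exact: mor_closed.
  rewrite (eq_irrelevance (subrK 1 0) degN1) gE /= hc_diff.
  by congr (- _); exact: compE.
have [e0 [ce0 /fib_coboundary[z1 [z2 [E1 E2]]]]] := (lex2 X 0 isT).2 _ cf.
have [P [c3 [eE rex3]]] := at_cokernel hA (CMor ce0).
pose eta : hom A X Y (-1) := - z1.
have deta : diff degN1 eta = mor (hc_f c1) - mor (hc_f c2) ∘ mor (hc_f c3).
  rewrite linearN /= (eq_irrelevance degN1 (subrK 1 0)); apply: etrans (congr1 -%R E1) _.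
  by rewrite opprB eE; congr (_ - _); exact: compE.
have hE : cohomologous (hc_h c1)
    (hc_h c2 ∘ mor (hc_f c3) - mor (hc_g c2) ∘l eta).
  exists z2; rewrite eE compNr opprK opprD addrA.
  move/(congr1 -%R): E2; rewrite opprD !opprK /= opprB => /(canRL (addKr _)) ->.
  by rewrite (addrC (- _)); congr (_ - _ - _); exact: compE.
have [S [iY [iP [pY [pP [hYY hPP hYP _ hS]]]]]] := (at_additive hA).2 Y P.
case: hYY => alpha dalpha; case: hYP => beta; rewrite subr0 => dbeta.
rewrite (eq_irrelevance (subrK 1 0) degN1) in dalpha dbeta.
have m_mono := left_exact_mono n0 trA lex2.
exists (Factorization deta); split=> //=.
apply: (coboundary_idm_epi1 rex3).
have gE' : mor (hc_g c1) = mor (hc_g c2) by rewrite gE.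
have rex4 := pushout_right_exact deta gE' hE rex1 rex2 rex3 hS dalpha dbeta.
have [lex4 _] := at_mono hA rex4 (pushout_mono c3 dalpha dbeta trA m_mono).
exact: (pushout_coker_zero hPP lex2 lex4).
Qed.

(** * Uniqueness: comparison of two factorizations *)

Lemma epi1_fib_acyclic X Y (e : cmor X Y) W i (p : Fib (precomp_map W e) i) :
  is_epi 1 e -> i <= 0 -> cocycle p -> coboundary p.
Proof.
move=> /epi1P/(_ W)[inj surj] le_i cp.
have bp1 : coboundary p.1.
  have /H_injP := inj i le_i; apply; last exact: fib_fst_null.
  by case/fib_cocycle: cp.
have [h [ch ph]] := fib_reduce cp bp1; apply: coboundary_cohomologous ph _.
have [|x [cx xh]] := surj (i - 1) _ h ch; first by lia.
apply/fib_coboundary0; exists (- x); split; first exact: cocycleN.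
by rewrite cmN; exact: cohomologous_sym.
Qed.

Lemma telescope3 (V : zmodType) (a b c d : V) :
  a - b + (c - a) + (d - c) = d - b.
Proof. by rewrite addrC addrA addrAC !addrA !subrK. Qed.

Lemma cancel_common (V : zmodType) (a b c d s t : V) :
  a - (b - c + d + s) + t + b - c = a - d - (s - t).
Proof.
rewrite -[LHS]addrA; move: (b - c) => {b c} b.
by rewrite -(addrA b) opprD addrA addrAC (addrAC _ _ b) subrK opprD opprB !addrA addrAC.
Qed.

Lemma fac_mor_exists X Y (f : cmor X Y) (F' F : factorization f) :
  abelian_truncated n A -> is_epi 1 (fac_e F') -> is_mono n (fac_m F) ->
  inhabited (fac_mor F' F).
Proof.
case: F' F => [X1 e' m' eta' deta'] [X0 e m eta deta] hA /= epi mono.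
have [R [c [mE rex]]] := at_cokernel hA m; subst m.
have [lex _] := at_mono hA rex mono; pose r := hc_g c.
have lr (u : hom A X Y (-1)) : diff degN1 (mor r ∘l u) = mor r ∘ diff degN1 u.
  by rewrite diff_comp_l; exact: compE.
(* The null-homotopy of [r m' e'] obtained by passing through [r f] to [r m e], which the exact
   sequence of [m] kills. *)
pose kappa : hom A X R (-1) := mor r ∘l eta' - mor r ∘l eta + hc_h c ∘ mor e.
have dkappa : diff degN1 kappa = - (mor r ∘ mor m' ∘ mor e').
  rewrite linearD linearB /= !lr deta deta' diff_comp_r hc_diff compNl -compBr.
  rewrite opprB (addrC (mor f - _)) addrA subrK compBr -!comp_rr.
  by rewrite addrAC subrr add0r.
(* Acyclicity of the fibre of [e'] extends [kappa] to a null-homotopy [lambda] of [r m'], up to the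
   correction [y]. *)
have [|x [y [dx dy]]] := (fib_coboundary _).1
    (epi1_fib_acyclic (p := (mor r ∘ mor m', kappa)) epi isT _).
  apply/fib_cocycle; split; first exact: ccomp_closed.
  by rewrite (eq_irrelevance (subrK 1 0) degN1).
rewrite /= in dx dy.
pose lambda : hom A X1 R (-1) := - x.
have dlambda : diff degN1 lambda = - (mor r ∘ mor m').
  by rewrite (eq_irrelevance degN1 (subrK 1 0)) linearN /= dx.
have lambda_e : lambda ∘ mor e' = kappa + diff (subrK 1 (0 - 1)) y.
  by rewrite -[kappa]dy subrK compNl.
have cm' : cocycle ((mor m', lambda) : Fib (postcomp_map X1 r) 0).
  apply/fib_cocycle; split; first exact: mor_closed.
  rewrite (eq_irrelevance (subrK 1 0) degN1) [LHS]dlambda; congr (- _).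
  exact: compE.
(* Since [X0] is the kernel of [r], the pair of [m'] and [lambda] lifts to [t]; the homotopy of
   pairs [(u, v)] supplies [hm] and the relation [rhm]. *)
have [t0 [ct /fib_coboundary[u [v [du dv]]]]] := (lex X1 0 isT).2 _ cm'.
pose t := CMor ct; pose hm : hom A X1 Y (-1) := - u.
have dhm : diff degN1 hm = mor m' - mor (hc_f c) ∘ mor t.
  rewrite (eq_irrelevance degN1 (subrK 1 0)) linearN /= du opprB.
  congr (_ - _); exact: compE.
have rhm : mor r ∘l hm = hc_h c ∘ mor t - lambda + diff (subrK 1 (0 - 1)) v.
  rewrite compNr; move/(canRL (subrK _)): dv => /= ->; congr (_ - _ + _).
  exact: compE.
(* e - t e' maps to the boundary of (xi, y - v e') in the fibre of r, so it is
   null by exactness; lifting this very boundary provides zeta. *)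
pose xi : hom A X Y (-1) := hm ∘ mor e' + eta' - eta.
have dxi : diff degN1 xi = mor (hc_f c) ∘ (mor e - mor t ∘ mor e').
  rewrite linearB linearD /= diff_comp_r dhm deta deta' opprB compBl compBr -comp_rr.
  exact: telescope3.
pose s : Fib (postcomp_map X r) (0 - 1) := (xi, y - v ∘ mor e').
have ds : diff (subrK 1 0) s = ker_map c X 0 (mor e - mor t ∘ mor e').
  rewrite fib_diff_pred; congr (_, _).
    rewrite (eq_irrelevance (subrK 1 0) degN1) [LHS]dxi; exact: compE.
  have -> : diff (subrK 1 (0 - 1)) (y - v ∘ mor e') =
      diff (subrK 1 (0 - 1)) y - diff (subrK 1 (0 - 1)) v ∘ mor e'.
    by rewrite linearB -diff_comp_r.
  have -> : postcomp_map X r (0 - 1) xi = hc_h c ∘ mor t ∘ mor e' - hc_h c ∘ mor e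
      - (diff (subrK 1 (0 - 1)) y - diff (subrK 1 (0 - 1)) v ∘ mor e').
    rewrite [LHS]/= compBr compDr -comp_lr rhm compDl compBl lambda_e /kappa.
    exact: cancel_common.
  rewrite opprB addrAC subrr (sub0r (_ - _)) opprB comp_rr -compBr; exact: compE.
have cz : cocycle (mor e - mor t ∘ mor e').
  by apply: cocycleB; [exact: mor_closed | exact: ccomp_closed].
have [he [dhe /fib_fst_cohomologous[zeta dzeta]]] :=
  H_lift_boundary (lex X 0 isT).1 (lex X (0 - 1) isT).2 cz ds.
split; apply: (@FacMor _ _ _ _ _ (Factorization deta') (Factorization deta)
  t he hm zeta) => //=.
- by rewrite (eq_irrelevance degN1 (subrK 1 0)).
rewrite (eq_irrelevance degN2 (subrK 1 (0 - 1))) [LHS]dzeta /= /xi.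
by rewrite !opprD opprK addrCA addrA.
Qed.

(** Precomposing with [e'] is injective on H^0, and both sides restrict to [e'] up to homotopy:
    first [t e'] is replaced by [e], then the other direction replaces it by [e']. *)
Lemma fac_mor_comp_id X Y (f : cmor X Y) (F' F : factorization f)
    (phi : fac_mor F' F) (psi : fac_mor F F') :
  is_epi 1 (fac_e F') ->
  cohomologous (mor (fm_t psi) ∘ mor (fm_t phi)) (idm (fac_obj F')).
Proof.
move=> /epi1P/(_ (fac_obj F'))[inj _].
apply: (inj 0 isT); [exact: ccomp_closed | exact: idm_cocycle |].
have E : precomp_map _ (fac_e F') 0 (idm (fac_obj F')) = mor (fac_e F').
  by rewrite -[RHS]comp_id_l; exact: compE.
rewrite E /= comp_rr.
apply: (@cohomologous_trans _ _ _ (mor (fm_t psi) ∘ mor (fac_e F))).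
  apply: cohomologous_sym; rewrite /cohomologous -compBr -fm_he_diff.
  exact: comp_coboundary_r (mor_closed _) (diff_coboundary _ _).
by apply: cohomologous_sym; rewrite /cohomologous -fm_he_diff; exact: diff_coboundary.
Qed.

End Exactness.

Theorem theorem2 (k : comPzRingType) (n : nat) (hn : (0 < n)%N)
    (A : dgCat k) (hA : abelian_truncated n A) (X Y : A) (f : cmor X Y) :
  (exists F : factorization f, is_1n_factorization n F) /\
  (forall F F' : factorization f,
     is_1n_factorization n F -> is_1n_factorization n F' -> fac_equiv F F').
Proof.
split=> [|F F' [eF mF] [eF' mF']]; first exact: image_factorization_exists.
(* The comparison is built in both directions; the two composites are then homotopic to identities
   because each first factor is a 1-epimorphism. *)
have [phi] := fac_mor_exists hA eF mF'; have [psi] := fac_mor_exists hA eF' mF.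
by exists phi, (fm_t psi); split; exact: fac_mor_comp_id.
Qed.
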